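(* Let $X$ be a set endowed with a negation operation $\neg:X\to X$, and let $(X,Cn)$ be a consequence structure. If $(X,Cn)$ is normal, explosive, satisfies joint consistency and satisfies the conjunctive property, then $(X,Cn_{\mathbb{P}})$ is paraconsistent.
   Context: A consequence structure is a pair $(X,Cn)$ where $X$ is a set and $Cn:\wp(X)\to\wp(X)$ is an arbitrary function. A subset $A\subseteq X$ is $Cn$-consistent if $Cn(A)\neq X$, and $Cn$-inconsistent otherwise. The operator $Cn_{\mathbb{P}}:\wp(X)\to\wp(X)$ is defined by $Cn_{\mathbb{P}}(A)=\bigcup\{Cn(A'):A'\subseteq A,\ A'\text{ is }Cn\text{-consistent}\}$. $(X,Cn)$ is normal if for all $A,B\subseteq X$: $A\subseteq Cn(A)$ (inclusion); $Cn(Cn(A))\subseteq Cn(A)$ (idempotency); and $A\subseteq B$ implies $Cn(A)\subseteq Cn(B)$ (monotonicity). The negation operation is just a function $\neg:X\to X$, $x\mapsto\neg x$, with no axioms. A consequence structure $(X,Cn)$ is explosive if for all $A\subseteq X$, whenever there is $x\in X$ with $x,\neg x\in Cn(A)$, then $Cn(A)=X$. It is paraconsistent if it is not explosive. It satisfies joint consistency if there exists $x\in X$ such that $\{x\}$ and $\{\neg x\}$ are both $Cn$-consistent and $\{x,\neg x\}$ is $Cn$-inconsistent. It satisfies the conjunctive property if for all $x,y\in X$ there exists $z\in X$ such that $Cn(\{x,y\})=Cn(\{z\})$. *)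

(* Defs.v *)
From mathcomp Require Import all_boot.
From mathcomp Require Import classical_sets.

Set Implicit Arguments.
Unset Strict Implicit.
Unset Printing Implicit Defensive.

Local Open Scope classical_set_scope.

(* A consequence structure (X, Cn) is a type X with an arbitrary
   Cn : set X -> set X; a negation is an arbitrary function neg : X -> X. *)

Definition cn_consistent (X : Type) (Cn : set X -> set X) (A : set X) : Prop :=
  Cn A <> [set: X].

Definition cn_inconsistent (X : Type) (Cn : set X -> set X) (A : set X) : Prop :=
  ~ cn_consistent Cn A.

Definition cnP (X : Type) (Cn : set X -> set X) (A : set X) : set X :=
  \bigcup_(B in [set B | B `<=` A /\ cn_consistent Cn B]) Cn B.

Definition inclusion (X : Type) (Cn : set X -> set X) : Prop :=
  forall A : set X, A `<=` Cn A.

Definition idempotency (X : Type) (Cn : set X -> set X) : Prop :=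
  forall A : set X, Cn (Cn A) `<=` Cn A.

Definition monotonicity (X : Type) (Cn : set X -> set X) : Prop :=
  forall A B : set X, A `<=` B -> Cn A `<=` Cn B.

Definition normal (X : Type) (Cn : set X -> set X) : Prop :=
  [/\ inclusion Cn, idempotency Cn & monotonicity Cn].

Definition explosive (X : Type) (neg : X -> X) (Cn : set X -> set X) : Prop :=
  forall A : set X, (exists x : X, Cn A x /\ Cn A (neg x)) -> Cn A = [set: X].

Definition paraconsistent (X : Type) (neg : X -> X) (Cn : set X -> set X) : Prop :=
  ~ explosive neg Cn.

Definition joint_consistency (X : Type) (neg : X -> X) (Cn : set X -> set X) :
    Prop :=
  exists x : X, [/\ cn_consistent Cn [set x], cn_consistent Cn [set neg x]
                  & cn_inconsistent Cn [set x; neg x]].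

Definition conjunctive_property (X : Type) (Cn : set X -> set X) : Prop :=
  forall x y : X, exists z : X, Cn [set x; y] = Cn [set z].

(* Main.v *)
Require Import Defs.
From mathcomp Require Import all_boot.
From mathcomp Require Import classical_sets.

Local Open Scope classical_set_scope.

(** Joint consistency provides a contradictory pair [x], [neg x] each of whose
    members is consistent alone, so [cnP Cn] of the pair contains both: were
    [cnP Cn] explosive, it would send the pair to the whole space. The
    conjunctive property condenses the pair into one point [z] with the same,
    total, set of consequences. Such a point generates everything, so it lies
    in no [Cn B] with [B] consistent, and therefore never in a value of [cnP Cn]
    ([inconsistent_point_notin_cnP]). Hence [z] is missing from [cnP Cn] of the
    pair. *)

(** A consistent singleton inside [A] is one of the sets whose consequences
    make up [cnP Cn A]. *)
Lemma consistent_point_in_cnP (X : Type) (Cn : set X -> set X) (A : set X)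
    (x : X) :
  inclusion Cn -> A x -> cn_consistent Cn [set x] -> cnP Cn A x.
Proof.
move=> incl Ax consx; exists [set x]; last exact: incl.
by split=> // _ ->.
Qed.

(** If [z] were in [Cn B] with [B] consistent, then monotonicity and idempotency
    would give [Cn [set z] `<=` Cn (Cn B) `<=` Cn B], making [B] inconsistent. *)
Lemma inconsistent_point_notin_cnP (X : Type) (Cn : set X -> set X) (A : set X)
    (z : X) :
  idempotency Cn -> monotonicity Cn -> Cn [set z] = [set: X] -> ~ cnP Cn A z.
Proof.
move=> idem mono Cnz [B [_ consB] CnBz]; apply: consB.
apply/seteqP; split=> // y _; apply: idem.
have zCnB : [set z] `<=` Cn B by move=> _ ->.
by apply: (mono _ _ zCnB); rewrite Cnz.
Qed.

Theorem theorem4p2 (X : Type) (neg : X -> X) (Cn : set X -> set X) :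
  normal Cn -> explosive neg Cn -> joint_consistency neg Cn ->
  conjunctive_property Cn ->
  paraconsistent neg (cnP Cn).
Proof.
move=> [incl idem mono] _ [x [consx consnx inconspair]] conj explP.
have [z pairz] := conj x (neg x).
(* Inconsistency is a double negation, which is harmless as the goal is
   [False]. *)
apply: inconspair => pairT.
apply: (@inconsistent_point_notin_cnP X Cn [set x; neg x] z idem mono).
  by rewrite -pairz.
rewrite (explP [set x; neg x]) //; exists x.
by split; apply: consistent_point_in_cnP => //; [left | right].
Qed.
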